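(* For every integer $d\ge 1$ and $k=3^d-3$, we have \[ \tau_k^{(d)} = \frac{3^d-1}{3^d+1}. \] In particular, $\tau^{(2)}_6 =4/5$ and $\tau_{24}^{(3)} = 13/14$.
   Context: For integers $d\ge 1$, $n\ge 2$, the $d$-dimensional toroidal kings graph $T^{(d)}[n]$ has vertex set $\{1,\ldots,n\}^d$, with coordinates read modulo $n$; distinct vertices $v,u$ are neighbors if and only if $v_i-u_i\equiv -1,0$ or $1\pmod n$ for each $i\in\{1,\ldots,d\}$. (When $n=2$ neighbors are counted with multiplicity, the number of neighbors of $v$ in $S$ being the number of nonzero $y\in\{-1,0,1\}^d$ with $v+y\in S$.) A set $S$ of vertices is $k$-dependent if each vertex of $S$ has at most $k$ neighbors in $S$. Let $\beta_k(T^{(d)}[n])$ be the maximum cardinality of a $k$-dependent set in $T^{(d)}[n]$, let $\tau^{(d)}_k(n)=\beta_k(T^{(d)}[n])/n^d$, and let $\tau^{(d)}_k=\lim_{n\to\infty}\tau^{(d)}_k(n)$ (this limit exists). *)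

(* Defs.v *)
(* MathComp / MathComp-Analysis. *)
From HB Require Import structures.
From mathcomp Require Import all_boot all_order all_algebra.
From mathcomp Require Import all_classical all_reals all_analysis.
Set Implicit Arguments.
Unset Strict Implicit.
Unset Printing Implicit Defensive.
Import Order.TTheory GRing.Theory Num.Theory.
Import numFieldNormedType.Exports.
Local Open Scope ring_scope.

(* Coordinates are represented by residues 0, ..., n-1 instead of 1, ..., n;
   they are only ever compared modulo n. *)
Definition vertex (d n : nat) : finType := {ffun 'I_d -> 'I_n}.

Definition kings_adj (d n : nat) : rel (vertex d n) :=
  fun v u => (v != u) &&
    [forall i, has (fun e : int => ((v i)%:Z - (u i)%:Z == e %[mod n%:Z])%Z)
                   [:: -1; 0; 1]].

(* An offset y in {-1,0,1}^d is encoded with values in {0,1,2}: the entry j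
   stands for j - 1. *)
Definition offset (d : nat) : finType := {ffun 'I_d -> 'I_3}.

Definition offset_val (d : nat) (y : offset d) (i : 'I_d) : int :=
  (y i)%:Z - 1.

Definition offset_nonzero (d : nat) (y : offset d) : bool :=
  [exists i, offset_val y i != 0].

Definition translate_in (d n : nat) (S : {set vertex d n}) (v : vertex d n)
    (y : offset d) : bool :=
  [exists u in S,
    [forall i, ((u i)%:Z == (v i)%:Z + offset_val y i %[mod n%:Z])%Z]].

(* For n = 2 the offsets 1 and -1 coincide modulo n and neighbors are counted
   with multiplicity. *)
Definition num_neighbors (d n : nat) (S : {set vertex d n}) (v : vertex d n)
    : nat :=
  if n == 2%N then #|[set y : offset d | offset_nonzero y & translate_in S v y]|
  else #|[set u in S | kings_adj v u]|.

Definition k_dependent (d n k : nat) (S : {set vertex d n}) : bool :=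
  [forall v in S, (num_neighbors S v <= k)%N].

Definition beta (d k n : nat) : nat :=
  \max_(S : {set vertex d n} | k_dependent k S) #|S|.

(* The graph is considered for n >= 2; the values at n = 0, 1 do not affect
   the limit below. *)
Definition tau_n (R : realType) (d k n : nat) : R :=
  (beta d k n)%:R / (n ^ d)%N%:R.

(* [limn] is total: meaningful only together with convergence. *)
Definition tau (R : realType) (d k : nat) : R := limn (tau_n R d k).

(* Main.v *)
Require Import Defs.
From mathcomp Require Import all_boot all_order all_algebra.
From mathcomp Require Import all_classical all_reals all_analysis.
From mathcomp Require Import zify ring.
Import Order.TTheory GRing.Theory Num.Theory.
Import numFieldNormedType.Exports.
Local Open Scope ring_scope.

(** A closed neighborhood of the kings graph has exactly [3 ^ d] points once
    [n > 2], so a set [S] is [(3 ^ d - 3)]-dependent exactly when the closed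
    neighborhood of each point of [S] contains at least two points outside [S]
    ([k_dependentE]).

    Upper bound.  Count the adjacent pairs formed by a point of [S] and a point
    outside [S]: there are at least [2 * #|S|] of them, and at most [3 ^ d - 1]
    for each of the [n ^ d - #|S|] points outside.  Hence
    [#|S| * (3 ^ d + 1) <= (3 ^ d - 1) * n ^ d] ([card_dependent_le]).

    Lower bound.  Equality would require the complement to be an independent
    set that is met exactly twice by every other closed neighborhood.  In the
    infinite lattice such sets exist.  Give the point [v] the weight [\sum_i
    v_i * 3 ^ i]; by existence and uniqueness of balanced ternary expansions,
    moving from [v] through its closed neighborhood changes the weight by each
    integer of absolute value at most [(3 ^ d - 1) / 2] exactly once.  Modulo
    [m = (3 ^ d + 1) / 2] these [3 ^ d = 2 * m - 1] consecutive changes take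
    the value [0] once and every other residue twice.  So each class of points
    of weight [r] modulo [m] is such a complement, and removing it leaves a
    proportion [1 - 1 / m = (3 ^ d - 1) / (3 ^ d + 1)] of the points.

    On the torus the weight is not well defined modulo [m] unless [m] divides
    [n].  The points with a coordinate [0] or [n - 1] are therefore removed
    too: the neighborhood of any remaining point does not wrap around
    ([interior_shift], [weight_class_compl_dependent]).  Averaging over [r]
    gives a class whose removal from the [(n - 2) ^ d] interior points leaves
    at least the expected proportion ([exists_large_weight_class_compl]).  Since
    [((n - 2) / n) ^ d] tends to [1], both bounds have the same limit. *)

(** * Closed neighborhoods *)

Definition near_mod {n : nat} (a b : 'I_n) : bool :=
  has (fun e : int => (a%:Z - b%:Z == e %[mod n%:Z])%Z) [:: -1; 0; 1].

Definition nbhd {d n : nat} (v : vertex d n) : {set vertex d n} :=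
  [set u : vertex d n | [forall i, near_mod (v i) (u i)]].

(** Writing the offset as [j - 1] with [j < 3] and moving the [1] to the other
    side turns the integer congruences into congruences of natural numbers. *)
Lemma near_modP {n : nat} (a b : 'I_n) :
  reflect (exists2 j : nat, (j < 3)%N & (b + 1 = a + j %[mod n])%N)
          (near_mod a b).
Proof.
apply: (iffP hasP) => [[e eP ab]|[j j3 /eqP ab]].
  have [j j3 eE] : exists2 j : nat, (j < 3)%N & e = 1 - j%:Z.
    by move: eP; rewrite !inE => /or3P[] /eqP ->;
      [exists 2%N | exists 1%N | exists 0%N].
  exists j => //; apply/eqP.
  rewrite -(eqz_nat (_ %% _)%N) -!modz_nat !PoszD eqz_mod_dvd.
  move: ab; rewrite eqz_mod_dvd eE -rpredN.
  by congr (_ %| _)%Z; lia.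
exists (1 - j%:Z); first by case: j j3 ab => [|[|[|]]].
move: ab.
rewrite -(eqz_nat (_ %% _)%N) -!modz_nat !PoszD !eqz_mod_dvd -rpredN.
by congr (_ %| _)%Z; lia.
Qed.

Lemma near_mod_refl {n : nat} (a : 'I_n) : near_mod a a.
Proof. by apply/near_modP; exists 1%N. Qed.

Lemma near_mod_sym {n : nat} (a b : 'I_n) : near_mod a b = near_mod b a.
Proof.
suff H (x y : 'I_n) : near_mod x y -> near_mod y x by apply/idP/idP; exact: H.
move=> /near_modP[j j3 xy]; apply/near_modP; exists (2 - j)%N; first lia.
apply/eqP; rewrite -(eqn_modDr j).
have -> : (y + (2 - j) + j = y + 1 + 1)%N by lia.
have -> : (x + 1 + j = x + j + 1)%N by lia.
by rewrite -(modnDml (y + 1)) xy modnDml.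
Qed.

(** The residues [a - 1], [a], [a + 1] are pairwise distinct because [n > 2]. *)
Lemma card_near_mod {n : nat} (a : 'I_n) :
  (2 < n)%N -> #|[pred b | near_mod a b]| = 3%N.
Proof.
case: n a => // n a n2.
(* The modulus is now [n.+1], so adding [n] subtracts [1]. *)
pose g (j : 'I_3) : 'I_n.+1 := inord ((a + j + n) %% n.+1).
have gE j : g j = ((a + j + n) %% n.+1)%N :> nat.
  by rewrite inordK // ltn_pmod.
have g_inj : injective g.
  move=> j k /(congr1 val) /=; rewrite !gE => /eqP.
  rewrite eqn_modDr eqn_modDl !modn_small; first by move/eqP/val_inj.
  - by apply: leq_trans (ltn_ord k) _.
  - by apply: leq_trans (ltn_ord j) _.
rewrite -[RHS](card_ord 3) -(card_codom g_inj); apply: eq_card => b.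
rewrite [LHS]/in_mem /=; apply/near_modP/codomP => [[j j3 ab]|[j ->]].
  exists (Ordinal j3); apply/val_inj; rewrite /= gE /=.
  rewrite -(modnDml (a + j)) -ab modnDml.
  by rewrite -addnA add1n modnDr modn_small.
by exists j => //; rewrite ?gE modnDml -addnA addn1 modnDr.
Qed.

Lemma nbhd_refl {d n : nat} (v : vertex d n) : v \in nbhd v.
Proof. by rewrite inE; apply/forallP => i; apply: near_mod_refl. Qed.

Lemma nbhd_sym {d n : nat} (u v : vertex d n) : (u \in nbhd v) = (v \in nbhd u).
Proof. by rewrite !inE; apply: eq_forallb => i; rewrite near_mod_sym. Qed.

Lemma card_nbhd {d n : nat} (v : vertex d n) :
  (2 < n)%N -> #|nbhd v| = (3 ^ d)%N.
Proof.
move=> n2; have -> : #|nbhd v| =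
    #|family (fun i => [pred b | near_mod (v i) b])|.
  by apply: eq_card => u; rewrite inE; apply/forallP/familyP.
rewrite card_family foldrE big_map big_enum /=.
under eq_bigr do rewrite card_near_mod //.
by rewrite prod_nat_const card_ord.
Qed.

(** The successor accounts for [v] itself, which belongs to its closed
    neighborhood and to [S]. *)
Lemma num_neighborsE {d n : nat} (S : {set vertex d n}) (v : vertex d n) :
  (2 < n)%N -> v \in S ->
  (num_neighbors S v + #|nbhd v :\: S|).+1 = (3 ^ d)%N.
Proof.
move=> n2 vS; rewrite -(card_nbhd v n2) -(cardsID S (nbhd v)).
rewrite /num_neighbors ifN; last by rewrite gtn_eqF.
rewrite (cardsD1 v (nbhd v :&: S)) inE nbhd_refl vS /= -addnA add1n.
congr (_ + _).+1; apply: eq_card => u.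
rewrite !inE /kings_adj [v == u]eq_sym [RHS]andbA andbC.
by case: (u \in S); rewrite ?andbF // andbT andTb andbC.
Qed.

(** The hypothesis on [d] makes the truncated subtraction [3 ^ d - 3] exact. *)
Lemma k_dependentE {d n : nat} (S : {set vertex d n}) :
  (0 < d)%N -> (2 < n)%N ->
  k_dependent (3 ^ d - 3) S = [forall v in S, 2 <= #|nbhd v :\: S|]%N.
Proof.
move=> d0 n2; apply: eq_forallb => v; case: (boolP (v \in S)) => //= vS.
have := num_neighborsE S v n2 vS.
have : (3 <= 3 ^ d)%N by rewrite -{1}(expn1 3) leq_exp2l.
move: (3 ^ d)%N (num_neighbors S v) => p q; move: (#|_|) => c; lia.
Qed.

(** * The upper bound *)

(** Double counting of the pairs [(v, u)] with [v] in [S] and [u] in the closed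
    neighborhood of [v] but outside [S]. *)
Lemma card_dependent_le {d n : nat} (S : {set vertex d n}) :
  (2 < n)%N -> [forall v in S, 2 <= #|nbhd v :\: S|]%N ->
  (#|S| * (3 ^ d + 1) <= (3 ^ d - 1) * n ^ d)%N.
Proof.
move=> n2 /forall_inP Sdep.
have le2 : (2 * #|S| <= (3 ^ d - 1) * #|~: S|)%N.
  rewrite ![(_ * #|_|)%N]mulnC -2!sum_nat_const.
  apply: leq_trans (leq_sum _ Sdep) _.
  under eq_bigr do rewrite -sum1_card big_mkcond /=.
  rewrite exchange_big [leqRHS]big_mkcond /=; apply: leq_sum => u _.
  rewrite -big_mkcondr /= sum1_card inE.
  case: (boolP (u \in S)) => uS /=.
    rewrite leqn0; apply/eqP/eq_card0 => v.
    by rewrite [LHS]unfold_in inE uS /= andbF.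
  (* The neighborhood of [u] contains [u], which lies outside [S], hence at most
     [3 ^ d - 1] points of [S]. *)
  rewrite subn1 -ltnS prednK ?expn_gt0 // -(card_nbhd u n2).
  apply: proper_card; apply/properP; split.
    by apply/fintype.subsetP => v /andP[_]; rewrite inE -nbhd_sym => /andP[].
  by exists u; [exact: nbhd_refl | rewrite unfold_in (negbTE uS)].
have := cardsC S; rewrite card_ffun !card_ord => cSC.
have : (0 < 3 ^ d)%N by rewrite expn_gt0.
nia.
Qed.

Lemma beta_le {d n : nat} : (0 < d)%N -> (2 < n)%N ->
  (beta d (3 ^ d - 3) n * (3 ^ d + 1) <= (3 ^ d - 1) * n ^ d)%N.
Proof.
move=> d0 n2; rewrite -leq_divRL ?addn1 //.
apply/bigmax_leqP => S; rewrite k_dependentE // => Sdep.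
by rewrite leq_divRL // -addn1 card_dependent_le.
Qed.

(** * The lower bound: removing a weight class *)

Lemma ternary_expansion (d t : nat) :
  (\sum_(i < d) ((t %/ 3 ^ i) %% 3) * 3 ^ i = t %% 3 ^ d)%N.
Proof.
elim: d => [|d IHd]; first by rewrite big_ord0 modn1.
rewrite big_ord_recr /= IHd.
have p0 : (0 < 3 ^ d)%N by rewrite expn_gt0.
have := ltn_pmod t p0; have := ltn_pmod (t %/ 3 ^ d) (isT : 0 < 3)%N.
move: (divn_eq t (3 ^ d)) (divn_eq (t %/ 3 ^ d) 3).
set s := (t %% 3 ^ d)%N; set q := (t %/ 3 ^ d)%N; set r := (q %% 3)%N.
move=> -> -> r3 sp.
rewrite mulnDl -mulnA -addnA -expnS modnMDl addnC modn_small // expnS; nia.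
Qed.

(** This is [(3 ^ d + 1) / 2]: the sum is [(3 ^ d - 1) / 2], the weight of the
    all-ones vector. *)
Definition weight_modulus (d : nat) : nat := (\sum_(i < d) 3 ^ i).+1.

Lemma double_weight_modulus (d : nat) : (2 * weight_modulus d = 3 ^ d + 1)%N.
Proof.
have := predn_exp 3 d; have : (0 < 3 ^ d)%N by rewrite expn_gt0.
rewrite /weight_modulus; lia.
Qed.

Definition ternary_weight {d n : nat} (v : vertex d n) : nat :=
  (\sum_i v i * 3 ^ i)%N.

Definition interior (d n : nat) : {set vertex d n} :=
  [set v : vertex d n | [forall i, 0 < v i < n.-1]%N].

Definition weight_class_compl (d n r : nat) : {set vertex d n} :=
  [set v in interior d n | ternary_weight v %% weight_modulus d != r]%N.

Lemma card_interior (d n : nat) : #|interior d n| = ((n - 2) ^ d)%N.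
Proof.
pose P := [pred a : 'I_n | 0 < a < n.-1]%N.
have -> : #|interior d n| = #|@ffun_on_mem 'I_d 'I_n (mem P)|.
  by apply: eq_card => v; rewrite inE; apply/forallP/ffun_onP.
rewrite card_ffun_on card_ord; congr (_ ^ _)%N.
rewrite /P; case: n {P} => [|[|n]].
- by apply: eq_card0 => -[].
- by apply: eq_card0 => a; rewrite inE /= andbC.
have g_inj : injective (fun i : 'I_n => inord i.+1 : 'I_n.+2).
  move=> i j /(congr1 val) /=; rewrite !inordK ?ltnS ?(ltnW (ltn_ord _)) //.
  by move=> [] /val_inj.
rewrite subSS subSS subn0 -[RHS](card_ord n) -(card_codom g_inj).
apply: eq_card => a; rewrite inE /=; apply/andP/codomP => [[a0 an]|[i ->]].
  have an' : (a.-1 < n)%N by lia.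
  by exists (Ordinal an'); apply/val_inj; rewrite /= inordK prednK.
by rewrite inordK !ltnS ?ltn_ord // ltnW.
Qed.

(** The digits of [t] in base [3], each lowered by [1], are the offset from [v]
    to [u]: the weight changes by [t - (3 ^ d - 1) / 2], and the equation avoids
    subtraction.  No coordinate leaves the range [0 .. n - 1] because [v] is
    interior, so the weight changes as it does in the infinite lattice. *)
Lemma interior_shift {d n : nat} (v : vertex d n) (t : nat) :
  v \in interior d n -> (t < 3 ^ d)%N ->
  exists2 u, u \in nbhd v &
    ((ternary_weight u).+1 + weight_modulus d =
      (ternary_weight v + t).+2)%N.
Proof.
rewrite inE => /forallP vint t3.
pose y (i : 'I_d) : nat := ((t %/ 3 ^ i) %% 3)%N.
have y3 i : (y i < 3)%N by rewrite ltn_pmod.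
have un (i : 'I_d) : ((v i + y i).-1 < n)%N.
  by have := vint i; have := y3 i; lia.
exists [ffun i => Ordinal (un i)].
  rewrite inE; apply/forallP => i; apply/near_modP; exists (y i) => //.
  by rewrite ffunE /= addn1 prednK // addn_gt0; case/andP: (vint i) => ->.
rewrite addSn /weight_modulus addnS; congr _.+2.
rewrite /ternary_weight -big_split /=.
rewrite -(modn_small t3) -ternary_expansion -big_split /=.
apply: eq_bigr => i _; rewrite ffunE /= -mulnDl -mulSnr.
by congr (_ * _)%N; rewrite prednK // addn_gt0; case/andP: (vint i) => ->.
Qed.

(** Shifting by [t] reaches weight [r] modulo [m] exactly when [t] is congruent
    to a certain [s < m].  The removed class does not contain [v], which
    excludes [s = m - 1], the zero shift; so both [s] and [s + m] are at most
    [2 * m - 2 = 3 ^ d - 1], and they lead to two removed points. *)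
Lemma weight_class_compl_dependent (d n r : nat) :
  (r < weight_modulus d)%N ->
  [forall v in weight_class_compl d n r,
     2 <= #|nbhd v :\: weight_class_compl d n r|]%N.
Proof.
move=> rm; apply/forall_inP => v; rewrite inE => /andP[vint].
have m0 : (0 < weight_modulus d)%N by [].
have := interior_shift v _ vint; have := double_weight_modulus d.
have : forall u, u \in weight_class_compl d n r ->
    (ternary_weight u %% weight_modulus d != r)%N.
  by move=> u; rewrite inE => /andP[].
(* The rest of the argument uses only these properties of the modulus. *)
move: (weight_modulus d) rm m0 => m rm m0 classP m2 shift vr.
(* This is the residue of [r - 1 - w], where [w] is the weight of [v]. *)
pose s := ((r + (m - (ternary_weight v %% m)) + (m - 1)) %% m)%N.
have sE : (ternary_weight v + s + 1 = r %[mod m])%N.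
  rewrite addnAC modnDmr addnAC -addnA -(modnDml (ternary_weight v)).
  have := ltn_pmod (ternary_weight v) m0.
  set w := (_ %% m)%N => wm.
  have -> : (w + (r + (m - w) + (m - 1) + 1) = r + m + m)%N by lia.
  by rewrite !modnDr.
have sm : (s < m)%N by exact: ltn_pmod.
move: s sE sm => s sE sm.
have {}sm : (s < m.-1)%N.
  suff : s != m.-1 by lia.
  apply: contra vr => /eqP s1; rewrite -(modn_small rm) -sE s1.
  by rewrite -addnA addn1 prednK // modnDr.
have outside t : (t < 3 ^ d)%N -> (t = s %[mod m])%N ->
    exists2 u, u \in nbhd v :\: weight_class_compl d n r &
      ((ternary_weight u).+1 + m = (ternary_weight v + t).+2)%N.
  move=> t3 ts; have [u uv uE] := shift t t3.
  exists u => //; rewrite inE uv andbT; apply/negP => /classP/eqP; apply.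
  rewrite -[RHS](modn_small rm) -sE -[LHS]modnDr.
  have -> : (ternary_weight u + m = ternary_weight v + t + 1)%N by lia.
  by rewrite -(modnDml (_ + t)) -(modnDmr _ t) ts modnDmr modnDml.
have [||u1 u1P u1E] := outside s; [lia|by []|].
have [||u2 u2P u2E] := outside (s + m)%N; [lia|by rewrite modnDr|].
(* The two points differ because their weights differ by [m > 0]. *)
have u12 : u1 != u2 by apply/eqP => u12; move: u2E; rewrite -u12; lia.
rewrite -(_ : #|[set u1; u2]| = 2%N); last by rewrite cards2 u12.
by apply: subset_leq_card; rewrite finset.subUset !finset.sub1set u1P u2P.
Qed.

(** Each interior point belongs to exactly one of the [m] classes, so the sets
    obtained by removing one class have total size [(m - 1) * (n - 2) ^ d], and
    one of them has at least the average size. *)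
Lemma exists_large_weight_class_compl (d n : nat) :
  exists2 r, (r < weight_modulus d)%N &
  ((3 ^ d - 1) * (n - 2) ^ d <= #|weight_class_compl d n r| * (3 ^ d + 1))%N.
Proof.
rewrite -double_weight_modulus; have := double_weight_modulus d.
rewrite -card_interior; set m := weight_modulus d => m2.
have m0 : (0 < m)%N by [].
have sumE : (\sum_(r < m) #|weight_class_compl d n r| =
             #|interior d n| * (m - 1))%N.
  under eq_bigr do rewrite -sum1_card.
  rewrite (exchange_big_dep (mem (interior d n))) /=; last first.
    by move=> r v _; rewrite inE => /andP[].
  rewrite -sum_nat_const; apply: eq_bigr => v vint; rewrite sum1_card.
  pose r0 : 'I_m := Ordinal (ltn_pmod (ternary_weight v) m0).
  have := cardC1 r0; rewrite card_ord -subn1 => <-.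
  apply: eq_card => r.
  by rewrite [LHS]unfold_in [LHS]inE vint inE [r == _]eq_sym.
have [r rP] : exists r : 'I_m,
    ((m - 1) * #|interior d n| <= #|weight_class_compl d n r| * m)%N.
  apply/existsP; apply: contraT; rewrite negb_exists => /forallP lt.
  have le : (\sum_(r < m) (#|weight_class_compl d n r| * m).+1 <=
             \sum_(r < m) (m - 1) * #|interior d n|)%N.
    by apply: leq_sum => r _; rewrite ltnNge; exact: lt.
  move: le; under eq_bigr do rewrite -addn1.
  rewrite big_split -big_distrl /= !sum_nat_const card_ord muln1.
  rewrite sumE mulnC [(_ * (m - 1))%N]mulnC.
  by rewrite -[leqRHS]addn0 leq_add2l leqNgt m0.
by exists r => //; nia.
Qed.

Lemma beta_ge {d n : nat} : (0 < d)%N -> (2 < n)%N ->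
  ((3 ^ d - 1) * (n - 2) ^ d <= beta d (3 ^ d - 3) n * (3 ^ d + 1))%N.
Proof.
move=> d0 n2; have [r rm rP] := exists_large_weight_class_compl d n.
apply: leq_trans rP _; rewrite leq_mul2r; apply/orP; right.
apply: (@leq_bigmax_cond _ _ (fun S : {set vertex d n} => #|S|)).
by rewrite k_dependentE // weight_class_compl_dependent.
Qed.

(** * The limit *)

Lemma tau_n_cvg (R : realType) (d : nat) : (0 < d)%N ->
  (tau_n R d (3 ^ d - 3) @ \oo --> ((3 ^+ d - 1) / (3 ^+ d + 1) : R))%classic.
Proof.
move=> d0; set c : R := (_ / _).
have p1 : (0 < 3 ^ d)%N by rewrite expn_gt0.
have cE : ((3 ^ d - 1)%N%:R / (3 ^ d + 1)%N%:R = c).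
  by rewrite natrB // natrD natrX.
have lim0 : ((1 - 2 * (n%:R : R)^-1) @[n --> \oo] --> (1 : R))%classic.
  rewrite -[X in (_ --> X)%classic]subr0 -[X in _ - X](mulr0 2).
  apply: cvgB; first exact: cvg_cst.
  apply: cvgMl_tmp; apply/gtr0_cvgV0; last exact: cvgr_idn.
  by near=> n; rewrite ltr0n; near: n; exact: nbhs_infty_gt.
have lim1 : ((c * (1 - 2 * (n%:R : R)^-1) ^+ d) @[n --> \oo] --> c)%classic.
  have {}lim0 := cvg_comp _ _ lim0 (@exprn_continuous R d 1).
  rewrite expr1n in lim0.
  rewrite -[X in (_ --> X)%classic]mulr1; exact: cvgMl_tmp.
apply: squeeze_cvgr lim1 (cvg_cst c); near=> n.
have n2 : (2 < n)%N by near: n; exact: nbhs_infty_gt.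
have n0 : 0 < n%:R :> R by rewrite ltr0n; lia.
have nd0 : 0 < (n ^ d)%N%:R :> R by rewrite natrX exprn_gt0.
have m0 : 0 < (3 ^ d + 1)%N%:R :> R by rewrite ltr0n addn1.
rewrite /tau_n -cE; apply/andP; split.
  rewrite ler_pdivlMr // -mulrA.
  have -> : (1 - 2 * n%:R^-1) ^+ d * (n ^ d)%N%:R = ((n - 2) ^ d)%N%:R :> R.
    rewrite !natrX -exprMn mulrBl mul1r mulfVK ?gt_eqF // natrB //.
    by rewrite ltnW.
  by rewrite mulrAC ler_pdivrMr // -!natrM ler_nat beta_ge.
rewrite ler_pdivrMr // mulrAC ler_pdivlMr // -!natrM ler_nat.
exact: beta_le.
Unshelve. all: by end_near.
Qed.

Theorem theorem3 (R : realType) :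
  [/\ forall d : nat, (1 <= d)%N ->
        cvgn (tau_n R d (3 ^ d - 3)%N) /\
        tau R d (3 ^ d - 3)%N = (3 ^+ d - 1) / (3 ^+ d + 1),
      tau R 2 6 = 4 / 5
    & tau R 3 24 = 13 / 14].
Proof.
have tauE d : (1 <= d)%N ->
    tau R d (3 ^ d - 3) = (3 ^+ d - 1) / (3 ^+ d + 1).
  by move=> d1; apply: cvg_lim (tau_n_cvg R d d1).
split=> [d d1||].
- by split; [apply/cvg_ex; eexists; exact: tau_n_cvg | exact: tauE].
- by rewrite (tauE 2%N) //; field.
- by rewrite (tauE 3%N) //; field.
Qed.
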